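(* Let $G$ be a graph of order $n\geq 4$ and let $\overline{G}$ be the reduced graph of $G$. Then $$m_{L(G)}(1)=p(G)-q(G)+m_{L(\overline{G})}(1).$$
   Context: All graphs are finite, simple and undirected. $L(G)=D(G)-A(G)$ is the Laplacian matrix of $G$ ($D(G)$ the diagonal degree matrix, $A(G)$ the adjacency matrix), and $m_{L(G)}(1)$ denotes the multiplicity of $1$ as an eigenvalue of $L(G)$. A pendant vertex is a vertex of degree $1$; a quasi-pendant vertex is a vertex adjacent to a pendant vertex. $p(G)$ and $q(G)$ denote the numbers of pendant and quasi-pendant vertices of $G$. A graph $G$ is called reduced if $p(G)=q(G)$. The reduced graph $\overline{G}$ of $G$ is obtained from $G$ by deleting pendant vertices until each quasi-pendant vertex is adjacent to exactly one pendant vertex (so that $p(\overline{G})=q(\overline{G})$). *)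

(* Defs.v *)
From mathcomp Require Import all_boot all_order all_algebra.

Set Implicit Arguments.
Unset Strict Implicit.
Unset Printing Implicit Defensive.

Import GRing.Theory.
Local Open Scope ring_scope.

Record sgraph := SGraph {
  svertex :> finType;
  adj : rel svertex;
  adj_sym : symmetric adj;
  adj_irrefl : irreflexive adj
}.

Section Pendant.
Variable G : sgraph.

Definition degree (x : G) : nat := #|[set y | adj x y]|.
Definition pendant (x : G) : bool := degree x == 1%N.
Definition pendant_nbrs (v : G) : {set G} := [set x | pendant x & adj v x].
Definition quasi_pendant (v : G) : bool := [exists x, pendant x && adj v x].

Definition num_pendant : nat := #|[set x : G | pendant x]|.
Definition num_quasi_pendant : nat := #|[set v : G | quasi_pendant v]|.

End Pendant.

Section Laplacian.
Variables (R : nzRingType) (G : sgraph).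

Definition adjacency_mx : 'M[R]_#|G| :=
  \matrix_(i, j) (adj (enum_val i) (enum_val j))%:R.
Definition degree_mx : 'M[R]_#|G| :=
  diag_mx (\row_i (degree (enum_val i))%:R).
Definition laplacian : 'M[R]_#|G| := degree_mx - adjacency_mx.

End Laplacian.

(* Algebraic multiplicity: the order of [a] as a root of the characteristic
   polynomial (0 if [a] is not an eigenvalue). *)
Definition eig_mult (F : fieldType) (n : nat) (A : 'M[F]_n) (a : F) : nat :=
  mup a (char_poly A).

Section Delete.
Variables (G : sgraph) (x : G).

Definition del_adj : rel {y : G | y != x} := fun u v => adj (val u) (val v).

Lemma del_adj_sym : symmetric del_adj.
Proof. by move=> u v; apply: adj_sym. Qed.

Lemma del_adj_irrefl : irreflexive del_adj.
Proof. by move=> u; apply: adj_irrefl. Qed.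

Definition del_vertex : sgraph := SGraph del_adj_sym del_adj_irrefl.

End Delete.

(* [reduced_graph_of G H]: H arises from G by successively deleting pendant
   vertices. A pendant vertex may be deleted only while its neighbour still has
   another pendant neighbour, so that every quasi-pendant vertex keeps one, and
   the process stops once each quasi-pendant vertex has exactly one. Pendant
   and quasi-pendant vertices are those of the current graph. The result is
   unique only up to isomorphism, hence a relation. *)
Inductive reduced_graph_of : sgraph -> sgraph -> Prop :=
| reduced_graph_stop (G : sgraph) :
    (forall v : G, quasi_pendant v -> #|pendant_nbrs v| = 1%N) ->
    reduced_graph_of G G
| reduced_graph_del (G H : sgraph) (v x : G) :
    x \in pendant_nbrs v -> (1 < #|pendant_nbrs v|)%N ->
    reduced_graph_of (del_vertex x) H -> reduced_graph_of G H.

Lemma reduced_graph_exists (G : sgraph) : exists H, reduced_graph_of G H.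
Proof.
have [n] := ubnP #|G|; elim: n G => // n IHn G leGn.
have [/forall_inP red|] :=
  boolP [forall (v : G | quasi_pendant v), #|pendant_nbrs v| == 1%N].
  by exists G; apply: reduced_graph_stop => v /red/eqP.
rewrite negb_forall_in => /exists_inP[v /existsP[x xv] n1].
have xP : x \in pendant_nbrs v by rewrite inE.
have gt1 : (1 < #|pendant_nbrs v|)%N.
  by rewrite ltn_neqAle eq_sym n1 card_gt0; apply/set0Pn; exists x.
have ltG : (#|del_vertex x| < n)%N.
  rewrite ltnS in leGn; apply: leq_trans leGn.
  rewrite card_sig [ltnRHS](cardD1 x) inE add1n ltnS.
  by apply/subset_leq_card/subsetP => y; rewrite !inE andbT.
by have [H redH] := IHn _ ltG; exists H; apply: reduced_graph_del xP gt1 redH.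
Qed.

(* Main.v *)
(** Since [L(G)] is symmetric over a real field, the multiplicity of [1] is
    [n - rank (L(G) - I)].  If [x] and [x'] are two pendant vertices at [v], they
    index equal rows and equal columns of [L(G) - I], so dropping [x] keeps the
    rank; adding row [x'], whose only nonzero entry is [-1] at [v], to row [v]
    then corrects the degree of [v] and yields [L(G - x) - I].  Hence each
    deletion lowers the multiplicity by exactly one.  It also lowers by one the
    sum over all [v] of (number of pendant neighbours of [v]) - 1, truncated at
    0: this sum equals [p(G) - q(G)] and vanishes on the reduced graph. *)

Require Import Defs.
From mathcomp Require Import all_boot all_order all_algebra.

Set Implicit Arguments.
Unset Strict Implicit.
Unset Printing Implicit Defensive.

Import Order.TTheory GRing.Theory Num.Theory.
Local Open Scope ring_scope.

(** * Algebraic multiplicity and rank for symmetric matrices *)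

(** Two block triangular factors each clear the block [C] of [M]: the one on the right has
    determinant 1, the one on the left has determinant [t ^+ n]. *)
Lemma det_scalar_sub_mulmxC (R : comNzRingType) (m n : nat) (t : R)
    (B : 'M[R]_(m, n)) (C : 'M[R]_(n, m)) :
  t ^+ n * \det (t%:M - B *m C) = t ^+ m * \det (t%:M - C *m B).
Proof.
pose M := block_mx t%:M B C 1%:M.
have detM : \det M = \det (t%:M - B *m C).
  have /(congr1 determinant) :
      M *m block_mx 1%:M 0 (- C) 1%:M = block_mx (t%:M - B *m C) B 0 1%:M.
    by rewrite mulmx_block !mulmx1 !mulmx0 !mul1mx mulmxN subrr !add0r.
  by rewrite det_mulmx det_lblock det_ublock !det1 !mulr1.
have /(congr1 determinant) :
    block_mx 1%:M 0 (- C) t%:M *m M = block_mx t%:M B 0 (t%:M - C *m B).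
  rewrite mulmx_block !mul1mx !mul0mx !addr0 !mulmx1 !mulNmx.
  by rewrite scalar_mxC addNr [in RHS]addrC.
by rewrite det_mulmx det_lblock det_ublock det1 !det_scalar mul1r detM.
Qed.

Lemma mulmx_tr_eq0 (F : realDomainType) (n : nat) (w : 'rV[F]_n) :
  w *m w^T = 0 -> w = 0.
Proof.
move=> /matrixP/(_ 0 0); rewrite !mxE => /eqP.
rewrite psumr_eq0 => [/allP w0|i _]; last by rewrite mxE -expr2 sqr_ge0.
apply/rowP => i; rewrite mxE.
by have := w0 i (mem_index_enum _); rewrite mxE mulf_eq0 orbb => /eqP.
Qed.

(* [row_base A *m col_base A] is the matrix of [A] restricted to its row space,
   which meets the kernel trivially because [w A = 0] and [w = y A] force
   [w w^T = y (w A)^T = 0]. *)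
Lemma sym_row_col_base_unit (F : realFieldType) (n : nat) (A : 'M[F]_n) :
  A^T = A -> row_base A *m col_base A \in unitmx.
Proof.
move=> symA; rewrite -row_free_unit -kermx_eq0; apply/rowV0P => u /sub_kermxP.
rewrite mulmxA => uRC0; set w := u *m row_base A in uRC0.
have wA0 : w *m A = 0 by rewrite -[X in _ *m X]mulmx_base mulmxA uRC0 mul0mx.
have [y wyA] : exists y, w = y *m A.
  by apply/submxP; rewrite -(eq_row_base A) submxMl.
suff /eqP : w = 0 by rewrite mulmx_free_eq0 ?row_base_free// => /eqP.
apply: mulmx_tr_eq0.
by rewrite {1}wyA -{1}symA -mulmxA -trmx_mul wA0 trmx0 mulmx0.
Qed.

(** Factor [B] as [C *m D] through its rank r. The determinant identity with t = X - a gives t^r *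
    char_poly A = t^n * q, and q(a) = det(- D C) is nonzero by symmetry. Comparing the orders of the
    root a yields r + mult = n. *)
Lemma eig_mult_sym (F : realFieldType) (n : nat) (A : 'M[F]_n) (a : F) :
  A^T = A -> (eig_mult A a + \rank (A - a%:M)%R)%N = n.
Proof.
move=> symA; set B := A - a%:M.
have symB : B^T = B by rewrite /B linearB /= symA tr_scalar_mx.
set C := map_mx polyC (col_base B); set D := map_mx polyC (row_base B).
pose t : {poly F} := 'X - a%:P; set q := \det (t%:M - D *m C).
have charA : char_poly A = \det (t%:M - C *m D).
  rewrite /char_poly /char_poly_mx -map_mxM mulmx_base map_mxB map_scalar_mx /=.
  by rewrite /t raddfB /= opprB addrA subrK.
have qa : ~~ root q a.
  rewrite /root -horner_evalE -det_map_mx map_mxB map_scalar_mx /= horner_evalE.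
  rewrite hornerXsubC subrr raddf0 sub0r -map_mxM -map_mx_comp.
  have -> N : map_mx (horner_eval a \o polyC) N = N :> 'M[F]_(\rank B).
    by apply/matrixP => i j; rewrite mxE /= horner_evalE hornerC.
  rewrite -scaleN1r detZ mulf_neq0 ?expf_neq0 ?oppr_eq0 ?oner_eq0//.
  by have := sym_row_col_base_unit symB; rewrite unitmxE unitfE.
have t0 k : t ^+ k != 0 by rewrite expf_neq0 ?polyXsubC_eq0.
have q0 : q != 0 by apply: contraNneq qa => ->; rewrite root0.
have := det_scalar_sub_mulmxC t C D; rewrite -charA -/q => /(congr1 (mup a)).
have char0 : char_poly A != 0 by rewrite monic_neq0 ?char_poly_monic.
by rewrite mupM// [RHS]mupMl// !mup_XsubCX eqxx addnC.
Qed.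

(** Selecting columns and then combining rows cannot raise the rank. [f] and [g] may repeat indices,
    so twin rows and columns can be duplicated as well as dropped. *)
Lemma mxrank_rowsub_add_le (F : fieldType) (m n p q : nat) (A : 'M[F]_(m, n))
    (B : 'M[F]_(p, q)) (f : 'I_p -> 'I_m) (g : 'I_q -> 'I_n) (b : 'I_m)
    (h : 'I_p -> F) :
  (forall i j, B i j = A (f i) (g j) + h i * A b (g j)) ->
  (\rank B <= \rank A)%N.
Proof.
move=> Bij; set A' := colsub g A.
have leA'A : (\rank A' <= \rank A)%N.
  by rewrite -mxrank_tr -[leqRHS]mxrank_tr trmx_mxsub mxrankS// rowsub_sub.
apply: leq_trans (mxrankS _) leA'A.
have -> : B = rowsub f A' + (\col_i h i) *m row b A'.
  by apply/matrixP => i j; rewrite Bij !mxE big_ord1 !mxE.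
by rewrite addmx_sub ?rowsub_sub// mulmx_sub ?row_sub.
Qed.

(** * Degrees and entries of the shifted Laplacian *)

Section Degrees.
Variable G : sgraph.

Lemma pendant_adjE (x v : G) :
  pendant x -> adj x v -> forall y, adj x y = (y == v).
Proof.
move=> /cards1P[w xw] xv y.
have adjE z : adj x z = (z == w) by move/setP/(_ z): xw; rewrite !inE.
by move: xv; rewrite !adjE => /eqP->.
Qed.

Lemma degree_del (x : G) (y : del_vertex x) :
  (degree y + adj (val y) x)%N = degree (val y).
Proof.
rewrite /degree [RHS](cardsD1 x) inE addnC; congr addn.
rewrite -(card_imset _ val_inj); apply: eq_card => z; rewrite !inE.
apply/imsetP/andP => [[w]|[zx yz]]; first by rewrite inE => yw ->; case: w yw.
by exists (Sub z zx); rewrite ?inE.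
Qed.

End Degrees.

Section LaplacianShift.
Variables (R : nzRingType) (G : sgraph).

(** The entries of L(G) - I, indexed by vertices because deleting a vertex renumbers the
    ordinals. *)
Definition lap1 (y z : G) : R :=
  ((degree y)%:R - 1) *+ (y == z) - (adj y z)%:R.

Lemma lap1E i j :
  (laplacian R G - 1%:M) i j = lap1 (enum_val i) (enum_val j).
Proof.
by rewrite /lap1 !mxE (inj_eq enum_val_inj) mulrnBl addrAC.
Qed.

Lemma trmx_laplacian : (laplacian R G)^T = laplacian R G.
Proof.
apply/matrixP => i j; rewrite !mxE adj_sym eq_sym.
by case: eqVneq => // ->.
Qed.

Lemma lap1_pendantl (x v y : G) :
  pendant x -> adj x v -> lap1 x y = - (y == v)%:R.
Proof.
by move=> px xv; rewrite /lap1 (eqP px) subrr mul0rn sub0r (pendant_adjE px xv).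
Qed.

Lemma lap1_pendantr (x v y : G) :
  pendant x -> adj x v -> lap1 y x = - (y == v)%:R.
Proof.
move=> px xv; rewrite /lap1 eq_sym adj_sym (pendant_adjE px xv).
by case: (eqVneq x y) => [<-|_]; rewrite ?(eqP px) ?subrr ?mulr0n sub0r.
Qed.

End LaplacianShift.

(** * Deleting one of two pendant vertices with a common neighbour *)

Section TwinPendants.
Variables (G : sgraph) (v x x' : G).
Hypotheses (px : pendant x) (px' : pendant x').
Hypotheses (xv : adj x v) (x'v : adj x' v) (x'x : x' != x).

Let vx : v != x.
Proof. by apply: contraTneq xv => ->; rewrite adj_irrefl. Qed.

Let x'Nv : x' != v.
Proof. by apply: contraTneq x'v => ->; rewrite adj_irrefl. Qed.

Lemma degree_del_pendant (y : del_vertex x) :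
  (degree y + (val y == v))%N = degree (val y).
Proof. by rewrite -(degree_del y) adj_sym (pendant_adjE px xv). Qed.

Lemma lap1_del (R : nzRingType) (y z : del_vertex x) :
  lap1 R y z = lap1 R (val y) (val z) + (val y == v)%:R * lap1 R x' (val z).
Proof.
rewrite (lap1_pendantl _ _ px' x'v) /lap1 -degree_del_pendant.
rewrite -(inj_eq val_inj y z) -[adj y z]/(adj (val y) (val z)).
case: (eqVneq (val y) v) => [->|_]; last by rewrite mul0r addr0 addn0.
rewrite mul1r [v == _]eq_sym natrD.
case: eqP => _; last by rewrite !mulr0n oppr0 addr0.
by rewrite /= ?mulr1n addrK [RHS]addrAC.
Qed.

Lemma mxrank_laplacian_del (F : fieldType) :
  \rank (laplacian F (del_vertex x) - 1%:M) = \rank (laplacian F G - 1%:M).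
Proof.
pose f (i : 'I_#|del_vertex x|) : 'I_#|G| := enum_rank (val (enum_val i)).
(* The default value folds the missing vertex [x] onto its twin [x']. *)
pose g (y : G) : del_vertex x := insubd (Sub x' x'x) y.
have gE y : val (g y) = if y == x then x' else y.
  by rewrite /g val_insubd; case: eqP.
have gv y : (val (g y) == v) = (y == v).
  rewrite gE; case: (eqVneq y x) => // ->.
  by rewrite (negPf x'Nv) eq_sym (negPf vx).
apply/eqP; rewrite eqn_leq; apply/andP; split.
  apply: (@mxrank_rowsub_add_le _ _ _ _ _ _ _ f f (enum_rank x')
            (fun i => (val (enum_val i) == v)%:R)) => i j.
  by rewrite !lap1E lap1_del !enum_rankK.
(* Conversely, subtracting row [x'] from row [v] undoes the degree correction, and copying row and
   column [x'] restores those of [x]. *)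
pose g' (i : 'I_#|G|) : 'I_#|del_vertex x| := enum_rank (g (enum_val i)).
apply: (@mxrank_rowsub_add_le _ _ _ _ _ _ _ g' g' (enum_rank (Sub x' x'x))
          (fun i => - (enum_val i == v)%:R)) => i j.
rewrite !lap1E !enum_rankK; set y := enum_val i; set z := enum_val j.
rewrite !lap1_del gv SubK (negPf x'Nv) mul0r addr0 mulNr addrK !gE.
by case: (eqVneq y x) => [->|_]; case: (eqVneq z x) => [->|_];
  rewrite ?(lap1_pendantl _ _ px xv) ?(lap1_pendantl _ _ px' x'v)
    ?(lap1_pendantr _ _ px xv) ?(lap1_pendantr _ _ px' x'v)
    ?(negPf x'Nv) // eq_sym (negPf vx).
Qed.

Lemma eig_mult_laplacian_del (R : realFieldType) :
  eig_mult (laplacian R G) 1 = (eig_mult (laplacian R (del_vertex x)) 1).+1.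
Proof.
have cardG : #|G| = #|del_vertex x|.+1.
  rewrite card_sig (cardD1 x) inE add1n; congr _.+1.
  by apply: eq_card => y; rewrite !inE andbT.
have multG := eig_mult_sym 1 (trmx_laplacian R G).
have := eig_mult_sym 1 (trmx_laplacian R (del_vertex x)).
move/(congr1 succn); rewrite -cardG -[RHS]multG mxrank_laplacian_del -addSn.
by move/addIn.
Qed.

End TwinPendants.

Section Excess.
Variable G : sgraph.

Definition pendant_excess : nat := (\sum_(v : G) #|pendant_nbrs v|.-1)%N.

Lemma quasi_pendantE (v : G) : quasi_pendant v = (0 < #|pendant_nbrs v|)%N.
Proof.
by rewrite card_gt0; apply/existsP/set0Pn => -[x xP]; exists x;
  move: xP; rewrite inE.
Qed.

(** Double counting of the pairs of a pendant vertex and a neighbour of it: each pendant vertex has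
    exactly one neighbour. *)
Lemma num_pendant_sum : num_pendant G = (\sum_(v : G) #|pendant_nbrs v|)%N.
Proof.
under eq_bigr do rewrite -sum1_card big_mkcond.
rewrite exchange_big /= /num_pendant -sum1_card big_mkcond /=.
apply: eq_bigr => x _; rewrite inE; case: ifP => px; last first.
  by rewrite big1 // => v _; rewrite inE px.
rewrite -big_mkcond sum1_card -[LHS](eqP px); apply: eq_card => v.
by rewrite -[RHS]/(x \in pendant_nbrs v) !inE px adj_sym.
Qed.

Lemma num_pendant_excess :
  num_pendant G = (num_quasi_pendant G + pendant_excess)%N.
Proof.
rewrite num_pendant_sum /num_quasi_pendant /pendant_excess -sum1_card.
rewrite [X in (X + _)%N]big_mkcond -big_split /=.
by apply: eq_bigr => v _; rewrite inE quasi_pendantE; case: #|_|.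
Qed.

End Excess.

(** The deletion lowers only the degree of [v], which may thereby become pendant. The summand at [v]
    drops by one, the one at [x] was 0, and all others keep their value. *)
Lemma pendant_excess_del (G : sgraph) (v x x' : G) :
    pendant x -> pendant x' -> adj x v -> adj x' v -> x' != x ->
  pendant_excess G = (pendant_excess (del_vertex x)).+1.
Proof.
move=> px px' xv x'v x'x.
have vx : v != x by apply: contraTneq xv => ->; rewrite adj_irrefl.
have vx' : v != x' by apply: contraTneq x'v => ->; rewrite adj_irrefl.
have sub_deg w : adj w v -> (#|[set x; x'; w]| <= degree v)%N.
  move=> wv; apply/subset_leq_card/subsetP => z; rewrite !inE -orbA adj_sym.
  by case/or3P => /eqP->.
have Npv : ~~ pendant v.
  have := sub_deg x xv; rewrite setUC setUA setUid cards2 eq_sym x'x /pendant.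
  by case: (degree v) => [|[|]].
have pn_leaf y : pendant y -> adj y v -> pendant_nbrs y = set0.
  move=> py yv; apply/setP => z; rewrite !inE (pendant_adjE py yv).
  by apply/andP => -[pz /eqP zv]; rewrite zv (negPf Npv) in pz.
(* A new pendant neighbour of [w] could only be [v], but then [x], [x'] and [w] are three neighbours
   of [v] in [G], so [v] keeps degree at least 2. *)
have pn_del (w : del_vertex x) : val w != x' ->
    val @: pendant_nbrs w = pendant_nbrs (val w) :\ x.
  move=> wx'; apply/setP => z; apply/imsetP/idP => [[u]|].
    rewrite !inE => /andP[pu wu ->]; rewrite (valP u) [adj _ _]wu andbT /=.
    move: (pu); rewrite /pendant -(degree_del_pendant px xv u).
    case: (eqVneq (val u) v) => [uv|_]; last by rewrite addn0.
    have := sub_deg (val w); rewrite -uv => /(_ wu).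
    rewrite -(degree_del_pendant px xv u) (eqP pu) uv eqxx.
    by rewrite setUC cardsU1 cards2 !inE negb_or (valP w) wx' eq_sym x'x.
  rewrite !inE => /and3P[zx pz wz]; exists (Sub z zx) => //.
  rewrite !inE; apply/andP; split=> //.
  have := degree_del_pendant px xv (Sub z zx); rewrite SubK (eqP pz).
  have /negPf-> : z != v by apply: contraNneq Npv => <-.
  by rewrite addn0 => /eqP.
rewrite /pendant_excess (bigD1 x) //= (pn_leaf x)// cards0 add0n.
rewrite (reindex_omap (val : del_vertex x -> G) insub) /=; last first.
  by move=> y yx; rewrite insubT.
under eq_bigl => w do rewrite (valP w) valK eqxx.
pose v0 : del_vertex x := Sub v vx.
rewrite (bigD1 v0) //= [in RHS](bigD1 v0) //= -addSn; congr addn.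
  rewrite -(card_imset (pendant_nbrs v0) val_inj) pn_del //=.
  (* Since [x'] remains next to [v], the truncated predecessor really drops by one. *)
  have [xP x'P] : x \in pendant_nbrs v /\ x' \in pendant_nbrs v :\ x.
    by rewrite !inE px px' x'x adj_sym xv adj_sym x'v.
  by rewrite (cardsD1 x) xP (cardsD1 x' (_ :\ x)) x'P.
apply: eq_bigr => w wv0; have wv : val w != v by rewrite -(inj_eq val_inj) in wv0.
(* At [x'] the count may rise from 0 to 1, if [v] has become pendant; its truncated predecessor is 0
   either way. *)
have [wx'|wx'] := eqVneq (val w) x'.
  rewrite wx' pn_leaf // cards0 /=.
  have : (#|pendant_nbrs (w : del_vertex x)| <= 1)%N.
    rewrite -(cards1 v0); apply/subset_leq_card/subsetP => u; rewrite !inE.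
    move=> /andP[_ wu]; have : adj x' (val u) by rewrite -wx'.
    by rewrite (pendant_adjE px' x'v).
  by case: #|_| => [|[]].
rewrite -(card_imset (pendant_nbrs (w : del_vertex x)) val_inj) pn_del //.
by rewrite [in LHS](cardsD1 x) !inE adj_sym (pendant_adjE px xv) (negPf wv) andbF.
Qed.

(** * Induction along the deletions *)

Lemma reduced_graph_eig_mult (R : realFieldType) (G H : sgraph) :
  reduced_graph_of G H ->
  eig_mult (laplacian R G) 1
    = (pendant_excess G + eig_mult (laplacian R H) 1)%N.
Proof.
elim=> {G H} [G redG|G H v x xv gt1 _ IH].
  rewrite /pendant_excess big1 // => v _.
  by have := redG v; rewrite quasi_pendantE; case: #|_| => // n ->.
have /set0Pn[x' /setD1P[x'x x'v]] : pendant_nbrs v :\ x != set0.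
  by rewrite -card_gt0; move: gt1; rewrite (cardsD1 x) xv.
move: xv x'v; rewrite !inE ![adj v _]adj_sym => /andP[px xv] /andP[px' x'v].
rewrite (eig_mult_laplacian_del px px' xv x'v x'x) IH.
by rewrite (pendant_excess_del px px' xv x'v x'x).
Qed.

Theorem theorem1p1 (R : rcfType) (G Gbar : sgraph)
    (hG : (4 <= #|G|)%N) (hGbar : reduced_graph_of G Gbar) :
  (eig_mult (laplacian R G) 1)%:Z
    = (num_pendant G)%:Z - (num_quasi_pendant G)%:Z
      + (eig_mult (laplacian R Gbar) 1)%:Z.
Proof.
rewrite (reduced_graph_eig_mult R hGbar) num_pendant_excess !PoszD.
by rewrite [X in X - _]addrC addrK.
Qed.
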